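(* Let $2\le n<\infty$ and $1\le k<\infty$. Any geometric progression state $\omega$ on $\mathcal{O}_n$ of order $k$ satisfies $\dim\mathcal{K}(\omega)\le k$. In particular, $\omega$ is finitely correlated.
   Context: For $2\le n<\infty$, $\mathcal{O}_n$ denotes the Cuntz algebra: the universal unital C$^*$-algebra generated by $s_1,\ldots,s_n$ with $s_i^*s_j=\delta_{ij}I$ and $\sum_{i=1}^n s_is_i^*=I$. Convention: $s_n^0=I$. Geometric progression state of order $k$: for $m=(n-1)k+1$, a state $\omega$ on $\mathcal{O}_n$ is a geometric progression state of order $k$ if there is a unit vector $z\in\mathbb{C}^m$ such that $\omega(s_n^rs_i)=\overline{z_{(n-1)r+i}}$ for all $r=0,\ldots,k-1$ and $i=1,\ldots,n-1$, and $\omega(s_n^k)=\overline{z_m}$. Let $\mathcal{I}_n:=\bigcup_{l\ge0}\{1,\ldots,n\}^l$ with $\{1,\ldots,n\}^0=\{\emptyset\}$; for $J=(j_1,\ldots,j_r)\in\mathcal{I}_n$, $s_J:=s_{j_1}\cdots s_{j_r}$, and $s_\emptyset:=I$. For a state $\omega$ on $\mathcal{O}_n$ with GNS representation $(\mathcal{H},\pi,\Omega)$, $\mathcal{K}(\omega)$ is the linear span of $\{\pi(s_J)^*\Omega: J\in\mathcal{I}_n\}$; $\omega$ is finitely correlated if $\dim\mathcal{K}(\omega)<\infty$. *)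

(* Defs.v *)
From HB Require Import structures.
From mathcomp Require Import all_boot all_order all_algebra sesquilinear.
From mathcomp Require Import complex.
From mathcomp Require Import all_classical all_reals all_analysis.

Set Implicit Arguments.
Unset Strict Implicit.
Unset Printing Implicit Defensive.

Import Order.TTheory GRing.Theory Num.Theory.
Import numFieldNormedType.Exports.

Local Open Scope classical_set_scope.
Local Open Scope ring_scope.

(* Unital C*-algebras over the complex numbers R[i]. The norm is real-valued and
   completeness is stated with sequences: MathComp's hierarchy has no join of
   its algebras with its normed modules. algType forces 1 != 0, so the zero
   algebra is excluded. *)
HB.mixin Record isCStar (R : realType) A of GRing.Algebra R[i] A := {
  star : A -> A;
  star_involutive : involutive star;
  star_semilinear : forall (c : R[i]) (x y : A),
    star (c *: x + y) = Num.conj c *: star x + star y;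
  star_antimul : forall x y : A, star (x * y) = star y * star x;
  cnorm : A -> R;
  cnorm_eq0 : forall x, cnorm x = 0 -> x = 0;
  cnorm_triangle : forall x y, cnorm (x + y) <= cnorm x + cnorm y;
  cnorm_scale : forall (c : R[i]) (x : A),
    (cnorm (c *: x))%:C%C = `|c| * (cnorm x)%:C%C;
  cnorm_submul : forall x y : A, cnorm (x * y) <= cnorm x * cnorm y;
  cnorm_star : forall x : A, cnorm (star x * x) = cnorm x ^+ 2;
  cnorm_complete : forall u : nat -> A,
    (forall e : R, 0 < e -> exists N : nat, forall p q : nat,
       (N <= p)%N -> (N <= q)%N -> cnorm (u p - u q) < e) ->
    exists x : A, (fun p => cnorm (u p - x)) @ \oo --> (0 : R) }.

#[short(type="cstarAlgType")]
HB.structure Definition CStarAlgebra (R : realType) :=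
  { A of GRing.Algebra R[i] A & isCStar R A }.

(* The inner product is linear in its first argument and conjugate-linear in
   the second one, as in the library's {dot _ for _}. *)
HB.mixin Record isHilbert (C : numClosedFieldType) H
    of CompleteNormedModule C H := {
  inner : {dot H for (@Num.conj C)};
  norm_inner : forall x : H, `|x| ^+ 2 = inner x x }.

#[short(type="hilbertType")]
HB.structure Definition Hilbert (C : numClosedFieldType) :=
  { H of CompleteNormedModule C H & isHilbert C H }.

Section Cuntz.
Variables (R : realType) (n : nat).
Local Notation C := R[i].

Definition cstar_closed (A : cstarAlgType R) (S : set A) : Prop :=
  forall (u : nat -> A) (x : A), (forall p, S (u p)) ->
    (fun p => cnorm (u p - x)) @ \oo --> (0 : R) -> S x.

Definition cuntz_family (A : cstarAlgType R) (s : 'I_n -> A) : Prop :=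
  (forall i j, star (s i) * s j = (i == j)%:R) /\
  \sum_i s i * star (s i) = 1.

(* The smallest closed unital *-subalgebra containing the s i is A. *)
Definition cstar_generates (A : cstarAlgType R) (s : 'I_n -> A) : Prop :=
  forall S : set A,
    cstar_closed S -> S 1 ->
    (forall (c : C) x y, S x -> S y -> S (c *: x + y)) ->
    (forall x y, S x -> S y -> S (x * y)) ->
    (forall x, S x -> S (star x)) ->
    (forall i, S (s i)) ->
    S = setT.

(* (A, s) is the universal unital C*-algebra generated by a Cuntz family; it
   determines (A, s) up to isomorphism. The 'lrmorphism' f is unital. *)
Definition is_cuntz_algebra (A : cstarAlgType R) (s : 'I_n -> A) : Prop :=
  [/\ cuntz_family s, cstar_generates s &
      forall (B : cstarAlgType R) (t : 'I_n -> B), cuntz_family t ->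
        exists f : {lrmorphism A -> B},
          (forall a, f (star a) = star (f a)) /\ (forall i, f (s i) = t i)].

End Cuntz.

Section States.
Variables (R : realType) (A : cstarAlgType R).
Local Notation C := R[i].

(* In R[i], 0 <= z means that z is real and nonnegative. *)
Definition is_state (omega : {scalar A}) : Prop :=
  (forall a, 0 <= omega (star a * a)) /\ omega 1 = 1.

Record star_rep (H : hilbertType C) := StarRep {
  rep_op :> A -> {linear H -> H};
  rep_bounded : forall a, continuous (rep_op a);
  rep_semilinear : forall (c : C) a b v,
    rep_op (c *: a + b) v = c *: rep_op a v + rep_op b v;
  rep_one : forall v, rep_op 1 v = v;
  rep_mul : forall a b v, rep_op (a * b) v = rep_op a (rep_op b v);
  rep_adjoint : forall a v w,
    inner (rep_op a v) w = inner v (rep_op (star a) w) }.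

(* The GNS representation is unique up to unitary equivalence; this is the
   type of all its realizations. *)
Record gns_rep (omega : {scalar A}) := GnsRep {
  gns_space : hilbertType C;
  gns_op : star_rep gns_space;
  gns_vec : gns_space;
  gns_cyclic : dense (range (fun a => gns_op a gns_vec));
  gns_state : forall a, omega a = inner (gns_op a gns_vec) gns_vec }.

End States.

Section Dimension.
Variables (K : fieldType) (V : lmodType K).

Definition lin_span (S : set V) : set V :=
  [set v | exists (r : nat) (c : 'I_r -> K) (x : 'I_r -> V),
     (forall i, S (x i)) /\ v = \sum_i c i *: x i].

Definition lin_indep (d : nat) (b : 'I_d -> V) : Prop :=
  forall c : 'I_d -> K, \sum_i c i *: b i = 0 -> forall i, c i = 0.

Definition has_dim (W : set V) (d : nat) : Prop :=
  exists b : 'I_d -> V, lin_indep b /\ lin_span (range b) = W.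

Definition finite_dim (W : set V) : Prop := exists d, has_dim W d.

Definition dim_le (W : set V) (k : nat) : Prop :=
  exists2 d, has_dim W d & (d <= k)%N.

End Dimension.

Section Correlation.
Variables (R : realType) (n : nat) (A : cstarAlgType R) (s : 'I_n -> A).

Definition gen_word (J : seq 'I_n) : A := \prod_(j <- J) s j.

(* pi(s_J)^* is pi(star s_J) by rep_adjoint. *)
Definition corr_space (omega : {scalar A}) (G : gns_rep omega)
    : set (gns_space G) :=
  lin_span (range (fun J => gns_op G (star (gen_word J)) (gns_vec G))).

Definition finitely_correlated (omega : {scalar A}) : Prop :=
  forall G : gns_rep omega, finite_dim (@corr_space omega G).

(* Generators and coordinates are numbered from 0: s_n is s (last_gen hn),
   and z_((n-1)r+i) with 1 <= i <= n-1 is coordinate (n-1)r+(i-1). *)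
Definition last_gen (hn : (1 < n)%N) : 'I_n :=
  Ordinal (etrans (ltn_predL n) (ltnW hn)).

Definition geometric_progression_state (hn : (1 < n)%N) (k : nat)
    (omega : {scalar A}) : Prop :=
  is_state omega /\
  exists z : 'rV[R[i]]_((n.-1 * k).+1),
    [/\ \sum_j `|z 0 j| ^+ 2 = 1,
        forall (r : 'I_k) (i : 'I_n.-1),
          omega (s (last_gen hn) ^+ r * s (widen_ord (leq_pred n) i)) =
          Num.conj (z 0 (inord (n.-1 * r + i)))
      & omega (s (last_gen hn) ^+ k) = Num.conj (z 0 ord_max)].

End Correlation.

Arguments corr_space [R n A] s [omega] G _.

(* Main.v *)
Require Import Defs.
From mathcomp Require Import all_boot all_order all_algebra.
From mathcomp Require Import sesquilinear.
From mathcomp Require Import complex.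
From mathcomp Require Import all_classical all_reals all_analysis.
Import Order.TTheory GRing.Theory Num.Theory.
Local Open Scope ring_scope.

(** The operators [s_n^r s_i] ([r < k], [i < n]) and [s_n^k] are isometries
    with pairwise orthogonal ranges, so their images of the cyclic unit vector
    [Omega] are orthonormal. The coefficients [z] of [Omega] along these vectors
    satisfy [sum |z_j|^2 = 1], so Bessel's inequality is an equality and
    [Omega = sum_j z_j t_j Omega]; applying [t_j^*] gives
    [t_j^* Omega = z_j Omega]. Hence the span of [(s_n^* )^r Omega], [r < k],
    is invariant under every [s_i^*] and equals the correlation space. *)

(** * Linear spans and their dimension *)

Section LinearSpan.
Context {K : fieldType} {V : lmodType K}.
Implicit Types S T : set V.

Lemma sub_lin_span S x : S x -> lin_span S x.
Proof.
by move=> Sx; exists 1%N, (fun=> 1), (fun=> x); rewrite big_ord1 scale1r.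
Qed.

Lemma lin_span0 S : lin_span S 0.
Proof.
by exists 0%N, (fun=> 0), (fun=> 0); split=> [[]//|]; rewrite big_ord0.
Qed.

Lemma lin_spanP S c x y :
  lin_span S x -> lin_span S y -> lin_span S (c *: x + y).
Proof.
move=> [p [a [u [Su ->]]]] [q [b [v [Sv ->]]]].
exists (p + q)%N.
exists (fun i => match fintype.split i with inl j => c * a j | inr j => b j end).
exists (fun i => match fintype.split i with inl j => u j | inr j => v j end).
split=> [i|]; first by case: (fintype.split i).
rewrite big_split_ord scaler_sumr; congr (_ + _); apply: eq_bigr => i _.
  by rewrite (unsplitK (inl i)) scalerA.
by rewrite (unsplitK (inr i)).
Qed.

Lemma lin_spanZ S c x : lin_span S x -> lin_span S (c *: x).
Proof.
by move=> Sx; rewrite -[c *: x]addr0; apply: lin_spanP => //; apply: lin_span0.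
Qed.

Lemma lin_span_sum S (I : finType) (c : I -> K) (x : I -> V) :
  (forall i, lin_span S (x i)) -> lin_span S (\sum_i c i *: x i).
Proof.
move=> Sx; elim/big_ind: _ => // [|u v Su Sv|i _]; first exact: lin_span0.
  by rewrite -[u]scale1r; apply: lin_spanP.
exact: lin_spanZ.
Qed.

Lemma lin_span_subset S T :
  (forall x, S x -> lin_span T x) -> forall x, lin_span S x -> lin_span T x.
Proof. by move=> ST x [r [c [y [Sy ->]]]]; apply: lin_span_sum => i; apply/ST. Qed.

Lemma lin_span_eq S T :
  (forall x, S x -> lin_span T x) -> (forall x, T x -> lin_span S x) ->
  lin_span S = lin_span T.
Proof. by move=> ST TS; apply/seteqP; split; apply: lin_span_subset. Qed.

Lemma dim_le_span_range k (b : 'I_k -> V) : dim_le (lin_span (range b)) k.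
Proof.
elim: k b => [|k IHk] b; first by exists 0%N => //; exists b; split=> // c _ [].
have [b_free|] := pselect (lin_indep b); first by exists k.+1 => //; exists b.
move=> /existsNP[c /not_implyP[c_b /existsNP[i /eqP ci_neq0]]].
have [d Wd dk] := IHk (fun j => b (lift i j)).
exists d; last exact: leqW.
suff -> : lin_span (range b) = lin_span (range (fun j => b (lift i j))) by [].
apply: lin_span_eq => _ [j _ <-]; last by apply: sub_lin_span; exists (lift i j).
case: (unliftP i j) => [l ->|->]; first by apply: sub_lin_span; exists l.
have -> : b i = \sum_j - (c (lift i j) / c i) *: b (lift i j).
  apply: (scalerI ci_neq0); move: c_b; rewrite (bigD1_ord i) //=.
  move=> /eqP; rewrite addr_eq0 => /eqP ->.
  rewrite scaler_sumr -sumrN; apply: eq_bigr => l _.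
  by rewrite scalerA mulrN mulrCA divff // mulr1 scaleNr.
by apply: lin_span_sum => l; apply: sub_lin_span; exists l.
Qed.

End LinearSpan.

(** * The equality case of Bessel's inequality *)

Section Bessel.
Context {C : numClosedFieldType} {H : hilbertType C} {I : finType}.

Lemma inner_eq0 (x : H) : inner x x = 0 -> x = 0.
Proof.
by move=> x0; apply/eqP; rewrite -normr_eq0 -sqrf_eq0 norm_inner x0.
Qed.

Lemma bessel_eq (e : I -> H) (z : I -> C) (x : H) :
  (forall i j, inner (e i) (e j) = (i == j)%:R) ->
  (forall i, inner (e i) x = Num.conj (z i)) ->
  inner x x = \sum_i `|z i| ^+ 2 ->
  x = \sum_i z i *: e i.
Proof.
move=> e_orth ex xx; apply/eqP; rewrite -subr_eq0; apply/eqP/inner_eq0.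
set y := x - _.
have ey i : inner (e i) y = 0.
  rewrite linearBr linear_sumr (bigD1 i) //= linearZr /= e_orth eqxx mulr1.
  rewrite ex big1 ?addr0 ?subrr // => j ji.
  by rewrite linearZr /= e_orth eq_sym (negPf ji) mulr0.
have xe i : inner x (e i) = z i.
  by rewrite (hermC inner) /= expr0 mul1r ex conjCK.
(* As [y] is orthogonal to every [e i], its squared norm is the inner product of [x] with [y], that
   is [inner x x] minus the sum of the [|z i| ^+ 2]. *)
rewrite {1}/y linearBl linear_sumlz [X in _ - X]big1 => [|i _]; last first.
  by rewrite linearZl /= ey mulr0.
rewrite subr0 /y linearBr linear_sumr /= xx -sumrB big1 // => i _.
by rewrite linearZr /= xe normCK mulrC subrr.
Qed.

End Bessel.

(** * Orthogonality relations among the isometries of the progression *)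

Section Isometries.
Context {R : realType} {A : cstarAlgType R}.

Lemma star1 : star (1 : A) = 1.
Proof.
have := star_antimul (star 1) (1 : A).
by rewrite mulr1 star_involutive mulr1.
Qed.

Lemma star_exp (a : A) p : star (a ^+ p) = star a ^+ p.
Proof.
by elim: p => [|p IHp]; rewrite ?star1 // exprS star_antimul IHp -exprSr.
Qed.

(* At most one of the two truncated differences is nonzero. *)
Lemma star_exp_mul_exp (a : A) p q : star a * a = 1 ->
  star a ^+ p * a ^+ q = star a ^+ (p - q) * a ^+ (q - p).
Proof.
move=> aa; elim: p q => [|p IHp] [|q] //=.
by rewrite exprSr exprS mulrA -(mulrA _ (star a)) aa mulr1 IHp !subSS.
Qed.

Context {n : nat} {hn : (1 < n)%N}.
Variables (k : nat) (s : 'I_n -> A).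
Hypothesis s_orth : forall i j, star (s i) * s j = (i == j)%:R.
Local Notation a := (s (last_gen hn)).
Local Notation b i := (s (widen_ord (leq_pred n) i)).

(* [None] stands for [s_n^k], the last coordinate. *)
Definition progression (x : option ('I_k * 'I_n.-1)) : A :=
  if x is Some (r, i) then a ^+ r * b i else a ^+ k.

Lemma widen_neq_last (i : 'I_n.-1) :
  (widen_ord (leq_pred n) i == last_gen hn) = false.
Proof. by apply/eqP => /(congr1 val) /= E; move: (ltn_ord i); rewrite E ltnn. Qed.

(** The inner powers of [a] cancel. If the exponents differ, a surplus [a] or [star a] remains next
    to some [star (b i)] or [b i], and the product vanishes; an index [r < k] always differs from
    the exponent of [a ^+ k]. Equal exponents leave [star (b i) * b j] or 1. *)
Lemma progression_orth x y :
  star (progression x) * progression y = (x == y)%:R.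
Proof.
have aa : star a * a = 1 by rewrite s_orth eqxx.
have ab i : star a * b i = 0 by rewrite s_orth eq_sym widen_neq_last.
have ba i : star (b i) * a = 0 by rewrite s_orth widen_neq_last.
have aX p i : star a ^+ p.+1 * b i = 0 by rewrite exprSr -mulrA ab mulr0.
have bX p i : star (b i) * a ^+ p.+1 = 0 by rewrite exprS mulrA ba mul0r.
case: x y => [[r i]|] [[q j]|] /=;
  rewrite ?star_antimul star_exp ?mulrA -?(mulrA _ (_ ^+ _) (_ ^+ _))
    star_exp_mul_exp //.
- have [rq|qr|rq] := ltngtP r q.
  + have /eqP -> : (r - q == 0)%N by rewrite subn_eq0 ltnW.
    rewrite mul1r -(subnSK rq) bX mul0r.
    by case: eqP => // -[E _]; move: rq; rewrite E ltnn.
  + have /eqP E0 : (q - r == 0)%N by rewrite subn_eq0 ltnW.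
    rewrite E0 mulr1 -(subnSK qr) -mulrA aX mulr0.
    by case: eqP => // -[E _]; move: qr; rewrite E ltnn.
  rewrite rq subnn !mulr1 s_orth; congr (nat_of_bool _)%:R.
  have -> : r = q by apply: val_inj.
  have E : widen_ord (leq_pred n) i = widen_ord (leq_pred n) j -> i = j.
    by move=> /(congr1 val) /= /val_inj.
  by apply/eqP/eqP => [/E -> | [->]].
- have /eqP -> : (r - k == 0)%N by rewrite subn_eq0 ltnW.
  by rewrite mul1r -(subnSK (ltn_ord r)) bX.
- have /eqP -> : (q - k == 0)%N by rewrite subn_eq0 ltnW.
  by rewrite mulr1 -(subnSK (ltn_ord q)) aX.
by rewrite subnn mulr1.
Qed.

End Isometries.

(** * Eigenvector equations in the GNS representation *)

Section Representation.
Context {R : realType} {A : cstarAlgType R} {omega : {scalar A}}.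
Variable G : gns_rep omega.
Local Notation Omega := (gns_vec G).

Lemma rep_op0 (v : gns_space G) : gns_op G 0 v = 0.
Proof.
have := rep_semilinear (gns_op G) 1 0 0 v.
by rewrite !scale1r addr0 => /esym/eqP; rewrite -subr_eq0 addrK => /eqP.
Qed.

Lemma gns_inner (x y : A) :
  inner (gns_op G x Omega) (gns_op G y Omega) = omega (star y * x).
Proof.
by rewrite (gns_state G) rep_mul [RHS]rep_adjoint star_involutive.
Qed.

Lemma gns_eigenvector (I : finType) (t : I -> A) (z : I -> R[i]) :
  (forall i j, star (t i) * t j = (i == j)%:R) -> omega 1 = 1 ->
  (forall i, omega (t i) = Num.conj (z i)) -> \sum_i `|z i| ^+ 2 = 1 ->
  forall i, gns_op G (star (t i)) Omega = z i *: Omega.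
Proof.
move=> t_orth omega1 omega_t z1 i.
have /(congr1 (gns_op G (star (t i)))) :
    Omega = \sum_j z j *: gns_op G (t j) Omega.
  apply: bessel_eq => [j l|j|].
  - rewrite gns_inner t_orth eq_sym.
    by case: eqP; rewrite ?omega1 ?raddf0.
  - by rewrite -omega_t (gns_state G).
  by rewrite z1 -omega1 (gns_state G) rep_one.
move=> ->; rewrite linear_sum (bigD1 i) //= linearZ /= -rep_mul t_orth eqxx.
rewrite rep_one big1 ?addr0 // => j ji.
by rewrite linearZ /= -rep_mul t_orth eq_sym (negPf ji) rep_op0 scaler0.
Qed.

End Representation.

(** * Numbering of the coordinates of [z] *)

Section Coordinates.
Variables k N : nat.

(** By [coordinate_lt], [inord] is only applied to values in range, so its default value never
    occurs. *)
Definition coordinate (x : option ('I_k * 'I_N)) : 'I_(N * k).+1 :=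
  if x is Some (r, i) then inord (N * r + i) else ord_max.

Lemma coordinate_lt (r : 'I_k) (i : 'I_N) : (N * r + i < N * k)%N.
Proof.
apply: (@leq_trans (N * r.+1)); last by rewrite leq_mul2l ltn_ord orbT.
by rewrite mulnS addnC ltn_add2r.
Qed.

(** Both sides have [N * k + 1] elements, so injectivity suffices; it is the uniqueness of quotient
    and remainder in division by [N]. *)
Lemma coordinate_bij : bijective coordinate.
Proof.
apply: inj_card_bij; last first.
  by rewrite card_option card_prod !card_ord mulnC.
have cE r i : val (coordinate (Some (r, i))) = (N * r + i)%N.
  by rewrite /= inordK // ltnS ltnW // coordinate_lt.
case=> [[r i]|] [[q j]|] // /(congr1 val); rewrite ?cE; last 2 first.
- by move=> E; move: (coordinate_lt r i); rewrite E ltnn.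
- by move=> E; move: (coordinate_lt q j); rewrite -E ltnn.
have N_gt0 : (0 < N)%N by apply: leq_ltn_trans (ltn_ord i).
rewrite !(mulnC N) => E.
have rq : val r = val q.
  by move/(congr1 (divn^~ N)): E; rewrite !divnMDl // !divn_small // !addn0.
by move: E; rewrite rq => /addnI/val_inj ->; rewrite (val_inj rq).
Qed.

End Coordinates.

Theorem theorem1p11 (R : realType) (n k : nat) (hn : (1 < n)%N)
    (hk : (0 < k)%N) (A : cstarAlgType R) (s : 'I_n -> A)
    (hA : is_cuntz_algebra s) (omega : {scalar A}) :
  geometric_progression_state s hn k omega ->
  (forall G : gns_rep omega, dim_le (corr_space s G) k) /\
  finitely_correlated s omega.
Proof.
case: hA => -[s_orth _] _ _ [[_ omega1] [z [z1 zE zk]]].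
suff dimK (G : gns_rep omega) : dim_le (corr_space s G) k.
  by split=> // G; have [d Kd _] := dimK G; exists d.
set Omega := gns_vec G; set a := s (last_gen hn).
have eig := @gns_eigenvector _ _ _ G _ (progression (hn := hn) k s)
  (fun x => z 0 (coordinate k n.-1 x)) (progression_orth k s s_orth) omega1.
have {}eig x : gns_op G (star (progression (hn := hn) k s x)) Omega =
    z 0 (coordinate k n.-1 x) *: Omega.
  apply: eig => [[[r i]|]|]; [exact: zE|exact: zk|].
  by rewrite -z1 (reindex _ (onW_bij _ (coordinate_bij k n.-1))).
pose v (r : 'I_k) := gns_op G (star a ^+ r) Omega.
(* This needs [0 < k]: [Omega] is the vector [v] at index 0. *)
have Omega_span c : lin_span (range v) (c *: Omega).
  apply/lin_spanZ/sub_lin_span; exists (Ordinal hk) => //.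
  by rewrite /v expr0 rep_one.
have v_inv j r : lin_span (range v) (gns_op G (star (s j)) (v r)).
  rewrite -rep_mul.
  have [->|j_last] := eqVneq j (last_gen hn).
    (* [star a] shifts the index by one; past the last index the vector is [star a ^+ k] applied to
       [Omega], a multiple of [Omega] by the eigenvector equation for [a ^+ k]. *)
    rewrite -exprS; case: (ltnP r.+1 k) => rk.
      by apply: sub_lin_span; exists (Ordinal rk).
    have -> : r.+1 = k by apply/eqP; rewrite eqn_leq rk ltn_ord.
    by rewrite -star_exp (eig None).
  have jn : (j < n.-1)%N.
    rewrite ltn_neqAle -ltnS prednK ?ltn_ord ?andbT; last exact: ltnW.
    by apply: contra j_last => /eqP E; apply/eqP/val_inj.
  have -> : j = widen_ord (leq_pred n) (Ordinal jn) by apply: val_inj.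
  (* [star (s j) * star a ^+ r] is the adjoint of [a ^+ r * s j], a member of the progression. *)
  by rewrite -star_exp -star_antimul (eig (Some (r, Ordinal jn))).
have s_inv j w : lin_span (range v) w ->
    lin_span (range v) (gns_op G (star (s j)) w).
  move=> [m [c [x [vx ->]]]]; rewrite linear_sum.
  under eq_bigr => l _ do rewrite linearZ /=.
  by apply: lin_span_sum => l; have [r _ <-] := vx l.
have word_inv J w : lin_span (range v) w ->
    lin_span (range v) (gns_op G (star (gen_word s J)) w).
  (* The star reverses the word, so its first letter acts first on [w]; hence the induction
     generalizes over [w]. *)
  elim: J w => [|j J IHJ] w vw; first by rewrite /gen_word big_nil star1 rep_one.
  by rewrite /gen_word big_cons star_antimul rep_mul; apply/IHJ/s_inv.
rewrite /corr_space (_ : lin_span _ = lin_span (range v)).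
  exact: dim_le_span_range.
apply: lin_span_eq => _ [x _ <-].
  by apply: word_inv; rewrite -[gns_vec G]scale1r.
(* Conversely, each [v x] comes from the constant word of length [x] in the last generator. *)
apply: sub_lin_span; exists (nseq x (last_gen hn)) => //.
by rewrite /gen_word big_nseq /v -star_exp -/a iter_mulr_1.
Qed.
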